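(* Let $\mathbb{R}^n_{>0}=\{(x^1,\dots,x^n)\in\mathbb{R}^n: x^i>0 \text{ for all } i\}$, and for $x,y\in\mathbb{R}^n_{>0}$ let $$d_F(x,y)=\left(\sum_{i=1}^n\big(\ln(y^i)-\ln(x^i)\big)^2\right)^{\frac12}.$$ Let $\mathbf{1}=(1,\dots,1)$. Then for every $\rho>0$ with $\rho\le1$, the ball $B_{d_F}(\mathbf{1},\rho)=\{x\in\mathbb{R}^n_{>0}: d_F(\mathbf{1},x)\le\rho\}$ is a convex subset of $\mathbb{R}^n$.
   Context: Convex is meant in the usual (Euclidean, line-segment) sense in $\mathbb{R}^n$. *)

(* Defs.v *)
From mathcomp Require Import all_boot all_order all_algebra.
From mathcomp Require Import all_classical all_reals all_analysis.
Set Implicit Arguments.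
Unset Strict Implicit.
Unset Printing Implicit Defensive.
Import Order.TTheory GRing.Theory Num.Theory.
Local Open Scope classical_set_scope.
Local Open Scope ring_scope.

Definition pos_orthant (R : realType) (n : nat) : set 'rV[R]_n :=
  [set x | forall i, 0 < x 0 i].

Definition dF (R : realType) (n : nat) (x y : 'rV[R]_n) : R :=
  Num.sqrt (\sum_(i < n) (ln (y 0 i) - ln (x 0 i)) ^+ 2).

(* The distance to the center is at most [rho]: the ball is closed.  Membership
   in the orthant cannot be dropped, since [ln] is total, with junk value [0]
   at nonpositive arguments. *)
Definition dF_ball (R : realType) (n : nat) (c : 'rV[R]_n) (rho : R) :
    set 'rV[R]_n :=
  [set x | pos_orthant x /\ dF c x <= rho].

(* Main.v *)
Require Import Defs.
From mathcomp Require Import all_boot all_order all_algebra.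
From mathcomp Require Import all_classical all_reals all_analysis.
From mathcomp Require Import ring lra.
Set Implicit Arguments.
Unset Strict Implicit.
Unset Printing Implicit Defensive.
Import Order.TTheory GRing.Theory Num.Theory.
Local Open Scope classical_set_scope.
Local Open Scope ring_scope.

(** The function [z |-> ln z ^+ 2] has derivative [2 ln z / z], which is
    nondecreasing on [(0, e]], so the function is convex there.  A point at
    distance at most 1 from [(1, ..., 1)] has all its coordinates in [(0, e]],
    hence the ball is a sublevel set of a sum of convex functions. *)

Lemma ln_div_le (R : realType) (x z : R) : 0 < x -> x <= z -> z <= expR 1 ->
  ln x / x <= ln z / z.
Proof.
move=> x0 xz ze; have z0 : 0 < z := lt_le_trans x0 xz.
have uv : ln x <= ln z by rewrite ler_ln ?posrE.
have v1 : ln z <= 1 by rewrite -ler_expR lnK.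
rewrite ler_pdivrMr // mulrAC ler_pdivlMr //.
(* This is [1 + u <= expR u] at [u = ln x - ln z], where [expR u = x / z]. *)
have zx : z * (1 + (ln x - ln z)) <= x.
  have := expR_ge1Dx (ln x - ln z).
  by rewrite expRD expRN !lnK // ler_pdivlMr // mulrC.
have [v0|v0] := leP 0 (ln z).
  (* Multiplying [zx] by [ln z] bounds [ln z * x] from below, and that bound exceeds [ln x * z] by
     exactly [z * (ln z - ln x) * (1 - ln z)]. *)
  have := mulr_ge0 (ltW z0) (mulr_ge0 (_ : 0 <= ln z - ln x) (_ : 0 <= 1 - ln z)).
  rewrite !subr_ge0 => /(_ uv v1).
  have := ler_wpM2l v0 zx.
  lra.
(* For [ln z < 0] monotonicity of [ln] suffices: [ln x * z <= ln z * z <= ln z * x]. *)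
rewrite (@le_trans _ _ (ln z * z)) ?ler_wpM2r ?(ltW z0) //.
by rewrite ler_wnM2l // ltW.
Qed.

Lemma is_derive_sqr_ln (R : realType) (x : R) : 0 < x ->
  is_derive x 1 (fun z => ln z ^+ 2) (2 * (ln x / x)).
Proof.
move=> x0; have dln := is_derive1_ln x0.
by apply: is_derive_eq; rewrite /GRing.scale /=; ring.
Qed.

Lemma sqr_ln_MVT (R : realType) (a b : R) : 0 < a -> a <= b ->
  exists2 c, a <= c <= b & ln b ^+ 2 - ln a ^+ 2 = 2 * (ln c / c) * (b - a).
Proof.
move=> a0 ab.
have drv (x : R) : a <= x -> is_derive x 1 (fun z => ln z ^+ 2) (2 * (ln x / x)).
  by move=> ax; apply/is_derive_sqr_ln/(lt_le_trans a0).
have [|||c] := @MVT_segment R (fun z => ln z ^+ 2) (fun x => 2 * (ln x / x)) a b.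
- exact: ab.
- by move=> x; rewrite in_itv /= => /andP[/ltW /drv].
- apply: derivable_within_continuous => x; rewrite in_itv /= => /andP[/drv dx _].
  exact: ex_derive.
- by rewrite in_itv /= => cab E; exists c.
Qed.

(** By the mean value theorem the chord between [x] and [z] has slope [2 * (ln c / c)] for some [c]
    between them; [ln_div_le] compares it with the tangent slope at [z], from above or below
    according to the side on which [x] lies. *)
Lemma sqr_ln_ge_tangent (R : realType) (x z : R) :
    0 < x -> 0 < z -> x <= expR 1 -> z <= expR 1 ->
  ln z ^+ 2 + 2 * (ln z / z) * (x - z) <= ln x ^+ 2.
Proof.
move=> x0 z0 xe ze; rewrite -lerBrDl.
have [zx|/ltW xz] := leP z x.
  have [c /andP[zc cx] ->] := sqr_ln_MVT z0 zx.
  rewrite ler_wpM2r ?subr_ge0 // ler_pM2l //.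
  by rewrite ln_div_le // (le_trans cx).
have [c /andP[xc cz] E] := sqr_ln_MVT x0 xz.
rewrite -[leRHS]opprB E -(opprB z) mulrN lerN2.
rewrite ler_wpM2r ?subr_ge0 // ler_pM2l //.
by rewrite ln_div_le // (lt_le_trans x0).
Qed.

(** Average the tangent inequalities at [z], taken at [x] and [y]: the linear terms cancel because
    [t * (x - z) + (1 - t) * (y - z) = 0]. *)
Lemma sqr_ln_convex (R : realType) (t x y : R) : 0 <= t -> t <= 1 ->
    0 < x -> 0 < y -> x <= expR 1 -> y <= expR 1 ->
  ln (t * x + (1 - t) * y) ^+ 2 <= t * ln x ^+ 2 + (1 - t) * ln y ^+ 2.
Proof.
move=> t0 t1 x0 y0 xe ye; set z := t * x + _.
have s0 : 0 <= 1 - t by rewrite subr_ge0.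
have z0 : 0 < z := @convR_gt0 R x y (Itv01 t0 t1) x0 y0.
have ze : z <= expR 1.
  have := lerD (ler_wpM2l t0 xe) (ler_wpM2l s0 ye).
  by rewrite -mulrDl subrKC mul1r.
have := lerD (ler_wpM2l t0 (sqr_ln_ge_tangent x0 z0 xe ze))
             (ler_wpM2l s0 (sqr_ln_ge_tangent y0 z0 ye ze)).
apply: le_trans; rewrite le_eqVlt; apply/orP; left; apply/eqP.
(* Naming the slope keeps its division by [z] out of the polynomial identity. *)
set d := 2 * _; rewrite /z; ring.
Qed.

Lemma dF_ball1P (R : realType) (n : nat) (rho : R) (x : 'rV[R]_n) : 0 <= rho ->
  dF_ball (const_mx 1) rho x <->
  pos_orthant x /\ \sum_(i < n) ln (x 0 i) ^+ 2 <= rho ^+ 2.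
Proof.
move=> rho0; rewrite /dF_ball /dF /=.
under eq_bigr do rewrite mxE ln1 subr0.
rewrite -{1}(ger0_norm rho0) -sqrtr_sqr ler_sqrt ?sqr_ge0 //.
Qed.

(** One square is at most the whole sum, so [ln (x 0 i)] is at most 1 in absolute value. This is
    where [rho <= 1] enters: it keeps the ball inside the region of convexity. *)
Lemma dF_ball1_le_expR1 (R : realType) (n : nat) (rho : R) (x : 'rV[R]_n) :
    0 <= rho -> rho <= 1 -> dF_ball (const_mx 1) rho x ->
  forall i, x 0 i <= expR 1.
Proof.
move=> rho0 rho1 /(dF_ball1P _ rho0)[xpos xle] i.
rewrite -[leLHS]lnK ?posrE ?xpos // ler_expR.
apply: le_trans (ler_norm _) _.
rewrite -(ler_pXn2r (ltn0Sn 1)) ?nnegrE // real_normK ?num_real //.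
apply: le_trans (le_trans xle _); last by rewrite ler_pXn2r ?nnegrE.
by rewrite (bigD1 i) //= lerDl sumr_ge0 // => j _; rewrite sqr_ge0.
Qed.

Theorem proposition3 (R : realType) (n : nat) (rho : R)
    (rho_gt0 : 0 < rho) (rho_le1 : rho <= 1) :
  convex_set (dF_ball (const_mx 1 : 'rV[R]_n) rho).
Proof.
have rho0 := ltW rho_gt0.
move=> x y t; rewrite !inE => xB yB.
have xe := dF_ball1_le_expR1 rho0 rho_le1 xB.
have ye := dF_ball1_le_expR1 rho0 rho_le1 yB.
move: xB yB => /(dF_ball1P _ rho0)[xpos xle] /(dF_ball1P _ rho0)[ypos yle].
have convE i : (conv t x y : 'rV[R]_n) 0 i =
    t%:num * x 0 i + (1 - t%:num) * y 0 i by rewrite !mxE.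
have [t0 t1] : 0 <= t%:num /\ t%:num <= 1 by [].
apply/(dF_ball1P _ rho0); split => [i|].
  by rewrite convE; apply: (@convR_gt0 R).
(* Convexity applies coordinate by coordinate; the resulting sum is a weighted average of two sums,
   each at most [rho ^+ 2]. *)
apply: (@le_trans _ _ (\sum_(i < n)
    (t%:num * ln (x 0 i) ^+ 2 + (1 - t%:num) * ln (y 0 i) ^+ 2))).
  by apply: ler_sum => i _; rewrite convE sqr_ln_convex.
rewrite big_split /= -!mulr_sumr.
have s0 : 0 <= 1 - t%:num by rewrite subr_ge0.
have := lerD (ler_wpM2l t0 xle) (ler_wpM2l s0 yle).
by rewrite -mulrDl subrKC mul1r.
Qed.
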